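(* Let $A\in\mathbb{C}^{q\times n}$, let $W\in\mathbb{C}^{n\times q}$ be nonzero, let $B\in\mathbb{C}^{q\times p}$, let $m$ be a positive integer and let $k=\max\{\mathrm{Ind}(AW),\mathrm{Ind}(WA)\}$. Then the constrained matrix approximation problem $$\min_{\mathcal{R}(X)\subseteq\mathcal{R}((WA)^k)}\Vert WA^{\star(m+1)}X-WA^{\star(m+1)}A^{\dag}B\Vert_F$$ over $X\in\mathbb{C}^{n\times p}$ has the unique solution $X=A^{\mathrm{wg}_m,W,\dag}B$.
   Context: $\Vert\cdot\Vert_F$ is the Frobenius norm; $M^{\dag}$ and $\mathcal{R}(M)$ are the Moore-Penrose inverse and range of a complex matrix $M$. For square $M$: $M^0=I$, $\mathrm{Ind}(M)$ is the smallest nonnegative integer $k$ with $\mathrm{rank}(M^k)=\mathrm{rank}(M^{k+1})$; the core-EP inverse $M^{\mathrm{cEP}}$ is the unique $X$ with $XMX=X$ and $\mathcal{R}(X)=\mathcal{R}(X^* )=\mathcal{R}(M^{\mathrm{Ind}(M)})$. For $X,Y\in\mathbb{C}^{q\times n}$ the $W$-product is $X\star Y=XWY$, and $X^{\star l}$ is the $l$-fold $W$-product of $X$ with itself. The weighted core-EP inverse is $A^{\mathrm{cEP},W}=A((WA)^{\mathrm{cEP}})^2$; the $W$-weighted $m$-weak group inverse is $A^{\mathrm{wg}_m,W}=(A^{\mathrm{cEP},W})^{\star(m+1)}WA^{\star m}\in\mathbb{C}^{q\times n}$. The $W$-weighted $m$-weak group MP inverse is $A^{\mathrm{wg}_m,W,\dag}=WA^{\mathrm{wg}_m,W}WAA^{\dag}\in\mathbb{C}^{n\times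 q}$. *)

(* Defs.v *)
From mathcomp Require Export all_boot all_order all_algebra.
From mathcomp Require Export classical_sets reals complex.

Set Implicit Arguments.
Unset Strict Implicit.
Unset Printing Implicit Defensive.

Import Order.TTheory GRing.Theory Num.Theory.

Local Open Scope ring_scope.
Local Open Scope sesquilinear_scope.
Local Open Scope classical_set_scope.

Definition argmin (T : Type) (R : realType) (S : set T) (f : T -> R) : set T :=
  [set x | S x /\ forall y, S y -> f x <= f y].

Section ComplexMatrices.
Variable R : realType.
Implicit Types m n p q : nat.

(* The column space; mathcomp's matrix-space operations act on row spaces. *)
Definition mxrange m n (M : 'M[R[i]]_(m, n)) : set 'cV[R[i]]_m :=
  range (fun x : 'cV[R[i]]_n => M *m x).

(* [complex.Re `|z|] is the modulus of [z], as an element of [R]. *)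
Definition frobenius_norm m n (M : 'M[R[i]]_(m, n)) : R :=
  Num.sqrt (\sum_i \sum_j complex.Re `|M i j| ^+ 2).

Definition penrose m n (M : 'M[R[i]]_(m, n)) : set 'M[R[i]]_(n, m) :=
  [set X | [/\ M *m X *m M = M, X *m M *m X = X,
               (M *m X)^t* = M *m X & (X *m M)^t* = X *m M]].

(* The default value [0] of [xget] is never used: every complex matrix has
   exactly one Moore-Penrose inverse. *)
Definition mp_inv m n (M : 'M[R[i]]_(m, n)) : 'M[R[i]]_(n, m) :=
  xget 0 (penrose M).

Lemma mxrank_exp_stationary n (M : 'M[R[i]]_n) :
  exists k, \rank (M ^+ k) == \rank (M ^+ k.+1).
Proof.
case: (boolP [exists k : 'I_n.+1, \rank (M ^+ k) == \rank (M ^+ k.+1)]).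
  by case/existsP=> k; exists k.
move=> /existsPn ne.
suff H k : (k <= n.+1 -> \rank (M ^+ k) + k <= n)%N.
  by have := H n.+1 (leqnn _); rewrite addnS ltnNge leq_addl.
elim: k => [_|k IHk lt_k]; first by rewrite addn0 rank_leq_row.
have /= := ne (Ordinal lt_k); rewrite eq_sym => nek.
have le : (\rank (M ^+ k.+1) <= \rank (M ^+ k))%N.
  by rewrite exprS; apply: mxrankM_maxr.
apply: leq_trans (IHk (ltnW lt_k)).
by rewrite addnS -addSn leq_add2r ltn_neqAle nek.
Qed.

Definition mx_index n (M : 'M[R[i]]_n) : nat := ex_minn (mxrank_exp_stationary M).

Definition is_core_ep n (M : 'M[R[i]]_n) : set 'M[R[i]]_n :=
  [set X | [/\ X *m M *m X = X, mxrange X = mxrange (X^t*) &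
               mxrange X = mxrange (M ^+ mx_index M)]].

(* The default value [0] of [xget] is never used: every square complex matrix
   has exactly one core-EP inverse. *)
Definition core_ep n (M : 'M[R[i]]_n) : 'M[R[i]]_n := xget 0 (is_core_ep M).

Section Weighted.
Variables (q n : nat) (W : 'M[R[i]]_(n, q)).
Implicit Types A X Y : 'M[R[i]]_(q, n).

Definition wprod X Y : 'M[R[i]]_(q, n) := X *m W *m Y.

(* [X] multiplied by itself [l] times, for [l] positive; the value [0] at
   [l = 0] is a placeholder, as [wprod] has no unit in general. *)
Definition wexp X l : 'M[R[i]]_(q, n) := iterop l wprod X 0.

Definition wcore_ep A : 'M[R[i]]_(q, n) := A *m core_ep (W *m A) ^+ 2.

Definition weak_group m A : 'M[R[i]]_(q, n) :=
  wexp (wcore_ep A) m.+1 *m W *m wexp A m.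

Definition weak_group_mp m A : 'M[R[i]]_(n, q) :=
  W *m weak_group m A *m W *m A *m mp_inv A.

End Weighted.
End ComplexMatrices.

(* Main.v *)
(** Put [M = W A], let [E] be its core-EP inverse and [V] the range of [M ^+ k].
    Then [M] restricts to a bijection of [V] whose inverse is the restriction of
    [E], and [M E] is the orthogonal projector [P] onto [V]; hence
    [M ^+ m.+1 *m E ^+ m.+1 = P] too. For [X] with range in [V], the range of
    [M ^+ m.+1 *m X] lies in [V], so by Pythagoras the distance from
    [M ^+ m.+1 *m X] to [M ^+ m.+1 *m C] is minimal exactly when
    [M ^+ m.+1 *m X = P *m M ^+ m.+1 *m C], that is, when
    [X = E ^+ m.+1 *m M ^+ m.+1 *m C]. The theorem is the case
    [C = mp_inv A *m B]. *)

Require Import Defs.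

Set Implicit Arguments.
Unset Strict Implicit.
Unset Printing Implicit Defensive.

Import Order.TTheory GRing.Theory Num.Theory.

Local Open Scope ring_scope.
Local Open Scope sesquilinear_scope.
Local Open Scope classical_set_scope.

(** * Adjoints and orthogonal projectors onto column spaces *)

Section ConjugateTranspose.
Variable C : numClosedFieldType.

Lemma trmxC_mul m n p (A : 'M[C]_(m, n)) (B : 'M[C]_(n, p)) :
  (A *m B)^t* = B^t* *m A^t*.
Proof. by rewrite trmx_mul map_mxM. Qed.

Lemma trmxCD m n (A B : 'M[C]_(m, n)) : (A + B)^t* = A^t* + B^t*.
Proof. by rewrite linearD map_mxD. Qed.

Lemma mul_trmxC_comm0 m n p (A : 'M[C]_(m, n)) (B : 'M[C]_(m, p)) :
  A^t* *m B = 0 -> B^t* *m A = 0.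
Proof.
move=> AB0; rewrite -[A]trmxCK -trmxC_mul AB0.
by rewrite trmx0 map_mx0.
Qed.

(** Gram-Schmidt applied to a row basis of [T^T] gives [U]; the columns of [U^T] are then an
    orthonormal basis [Q] of the column space of [T], and [Q Q^*] is the projector. *)
Lemma ortho_projector_exists m n (T : 'M[C]_(m, n)) :
  exists P : 'M[C]_m,
    [/\ P^t* = P, P *m T = T & exists Z : 'M[C]_(n, m), P = T *m Z].
Proof.
pose U := schmidt (row_base T^T).
have le_rT : (\rank T^T <= m)%N := rank_leq_col _.
have eqUT : (U :=: T^T)%MS.
  apply: (eqmx_trans _ (eq_row_base T^T)).
  by apply: eqmx_schmidt_free; rewrite ?row_base_free.
have UU : U *m U^t* = 1%:M by apply/unitarymxP/schmidt_unitarymx.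
have [D TD] : exists D, T^T = D *m U by apply/submxP; rewrite eqUT.
have [D' UD'] : exists D', U = D' *m T^T by apply/submxP; rewrite -eqUT.
have defT : T = U^T *m D^T by rewrite -trmx_mul -TD trmxK.
have defU : U^T = T *m D'^T.
  by have /(congr1 trmx) := UD'; rewrite trmx_mul trmxK.
have QQ : (U^T)^t* *m U^T = 1%:M.
  by apply: trmx_inj; rewrite trmx1 -UU trmx_mul !trmxK map_trmx.
exists (U^T *m (U^T)^t*); split.
- by rewrite trmxC_mul trmxCK.
- apply: etrans (congr1 (mulmx _) defT) _.
  by rewrite mulmxA -(mulmxA U^T) QQ mulmx1 -defT.
- by exists (D'^T *m (U^T)^t*); rewrite mulmxA -defU.
Qed.

End ConjugateTranspose.

(** * The Frobenius norm as a trace, and Pythagoras *)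

Section FrobeniusNorm.
Variable R : realType.

Lemma frobenius_norm_ge0 m n (X : 'M[R[i]]_(m, n)) : 0 <= frobenius_norm X.
Proof. exact: sqrtr_ge0. Qed.

Lemma sqr_frobenius_norm m n (X : 'M[R[i]]_(m, n)) :
  ((frobenius_norm X ^+ 2)%:C)%C = \tr (X^t* *m X).
Proof.
rewrite sqr_sqrtr; last by do 2![apply: sumr_ge0 => ? _]; exact: sqr_ge0.
rewrite rmorph_sum /mxtrace.
under eq_bigr => i _ do rewrite rmorph_sum.
rewrite exchange_big /=; apply: eq_bigr => j _.
rewrite mxE; apply: eq_bigr => i _.
by rewrite rmorphXn /= -[(_%:C)%C]/`|X i j| normCK !mxE mulrC.
Qed.

Lemma frobenius_norm_eq0 m n (X : 'M[R[i]]_(m, n)) :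
  frobenius_norm X = 0 -> X = 0.
Proof.
move=> X0; have := sqr_frobenius_norm X; rewrite X0 expr0n /= => /esym/eqP.
rewrite /mxtrace psumr_eq0 => [/allP tr0|j _]; last first.
  by rewrite mxE sumr_ge0 // => i _; rewrite !mxE mulrC -normCK exprn_ge0.
apply/matrixP => i j; rewrite mxE.
have := tr0 j (mem_index_enum _); rewrite /= mxE psumr_eq0 => [/allP s0|l _].
  have := s0 i (mem_index_enum _).
  by rewrite /= !mxE mulrC -normCK expf_eq0 /= normr_eq0 => /eqP.
by rewrite !mxE mulrC -normCK exprn_ge0.
Qed.

Lemma frobenius_norm_pythagoras m n (X Y : 'M[R[i]]_(m, n)) :
  X^t* *m Y = 0 ->
  frobenius_norm (X + Y) ^+ 2 = frobenius_norm X ^+ 2 + frobenius_norm Y ^+ 2.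
Proof.
move=> XY0; apply: complexI; rewrite rmorphD /= !sqr_frobenius_norm -mxtraceD.
by rewrite trmxCD mulmxDl !mulmxDr XY0 (mul_trmxC_comm0 XY0) addr0 add0r.
Qed.

End FrobeniusNorm.

(** * Least squares under a range constraint *)

Section Projection.
Variable R : realType.

Lemma mxrange_subP m n p (X : 'M[R[i]]_(m, n)) (Y : 'M[R[i]]_(m, p)) :
  mxrange X `<=` mxrange Y <-> exists Z, X = Y *m Z.
Proof.
split=> [sXY|[Z ->] _ [x _ <-]]; last by exists (Z *m x); rewrite ?mulmxA.
have /submxP[D XD] : (X^T <= Y^T)%MS.
  apply/row_subP => j; have [|y _ Yy] := sXY (col j X).
    by exists (delta_mx j 0); rewrite // colE.
  by rewrite -tr_col -Yy trmx_mul submxMl.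
by exists D^T; rewrite -[X]trmxK XD trmx_mul trmxK.
Qed.

(** The residual splits as [(N X - P N C) + Y]: for feasible [X] the first term is fixed by [P],
    while [P] kills [Y], so the two are orthogonal and only the first depends on [X]. *)
Lemma argmin_frobenius_projection n p (N F P V : 'M[R[i]]_n)
    (C : 'M[R[i]]_(n, p)) :
  P^t* = P -> N *m F = P -> F *m P = F -> P *m N *m V = N *m V ->
  F *m N *m V = V -> mxrange F `<=` mxrange V ->
  argmin [set X : 'M[R[i]]_(n, p) | mxrange X `<=` mxrange V]
    (fun X => frobenius_norm (N *m X - N *m C)) = [set F *m N *m C].
Proof.
move=> Ph NF FP PNV FNV /mxrange_subP[Z FZ].
pose Y := P *m N *m C - N *m C.
have dist X : mxrange X `<=` mxrange V ->
  frobenius_norm (N *m X - N *m C) ^+ 2 =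
  frobenius_norm (N *m X - P *m N *m C) ^+ 2 + frobenius_norm Y ^+ 2.
  move=> /mxrange_subP[D ->].
  rewrite -frobenius_norm_pythagoras ?addrA ?subrK //.
  have PP : P *m P = P by rewrite -{1}NF -mulmxA FP.
  have -> : N *m (V *m D) - P *m N *m C = P *m (N *m (V *m D) - N *m C).
    by rewrite mulmxBr !mulmxA PNV.
  by rewrite trmxC_mul Ph -mulmxA /Y mulmxBr !mulmxA PP subrr mulmx0.
have feas : mxrange (F *m N *m C) `<=` mxrange V.
  by apply/mxrange_subP; exists (Z *m N *m C); rewrite FZ !mulmxA.
have opt : frobenius_norm (N *m (F *m N *m C) - N *m C) = frobenius_norm Y.
  by rewrite /Y !mulmxA NF.
apply/seteqP; split=> X /=.
  case=> feasX /(_ _ feas); rewrite opt.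
  (* Comparison with the feasible point [F N C], whose residual is exactly [Y], leaves no room for
     the first term. *)
  rewrite -ler_sqr ?nnegrE ?frobenius_norm_ge0 // dist // gerDr => le0.
  have /frobenius_norm_eq0/subr0_eq NX :
      frobenius_norm (N *m X - P *m N *m C) = 0.
    by apply/eqP; rewrite -sqrf_eq0 eq_le le0 sqr_ge0.
  have [D XD] := (mxrange_subP _ _).1 feasX.
  (* Since [X = V D], [F N] fixes [X]; hence [X = F N X = F P N C = F N C]. *)
  rewrite -[F in RHS]FP -!mulmxA (mulmxA P) -NX XD.
  by rewrite !mulmxA FNV.
move=> ->; split=> // X' feasX'; rewrite opt.
by rewrite -ler_sqr ?nnegrE ?frobenius_norm_ge0 // dist // lerDr sqr_ge0.
Qed.

End Projection.

Section MatrixPowers.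
Variables (R : pzRingType) (n : nat) (M : 'M[R]_n).

Lemma expmxD i j : M ^+ (i + j) = M ^+ i *m M ^+ j.
Proof. exact: exprD. Qed.

Lemma expmxC i j : M ^+ i *m M ^+ j = M ^+ j *m M ^+ i.
Proof. by rewrite -!expmxD addnC. Qed.

Lemma expmxS i : M ^+ i.+1 = M *m M ^+ i.
Proof. exact: exprS. Qed.

Lemma expmxSr i : M ^+ i.+1 = M ^+ i *m M.
Proof. exact: exprSr. Qed.

End MatrixPowers.

(** * Existence and algebra of the core-EP inverse *)

Section CoreEP.
Variables (R : realType) (n : nat) (M : 'M[R[i]]_n).

(** The column space of the higher power lies in that of the lower one, and at the index the ranks
    agree, so the spaces coincide. *)
Lemma mx_index_factor : exists Y, M ^+ mx_index M = M ^+ (mx_index M).+1 *m Y.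
Proof.
rewrite /mx_index; case: ex_minnP => j /eqP rk _.
have s : ((M ^+ j.+1)^T <= (M ^+ j)^T)%MS.
  by rewrite expmxSr trmx_mul submxMl.
have /submxP[D MD] : ((M ^+ j)^T <= (M ^+ j.+1)^T)%MS.
  by rewrite -(geq_leqif (mxrank_leqif_sup s)) !mxrank_tr rk.
by exists D^T; rewrite -[LHS]trmxK MD trmx_mul trmxK.
Qed.

Lemma mx_index_factor_ge k : (mx_index M <= k)%N ->
  exists Y, M ^+ mx_index M = M ^+ k *m Y.
Proof.
move=> /subnK <-; elim: (k - _)%N => [|d [Y IH]].
  by exists 1%:M; rewrite mulmx1.
have [Y1 e] := mx_index_factor; exists (Y1 *m Y).
by rewrite {1}IH {1}expmxD {1}e addSnnS expmxD !mulmxA.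
Qed.

Lemma core_epP : is_core_ep M (core_ep M).
Proof.
suff : exists E, is_core_ep M E by exact: xgetPex.
set j := mx_index M.
have [Y MY] := mx_index_factor.
have [P [Ph PV [Z PZ]]] := ortho_projector_exists (M ^+ j).
have PP : P *m P = P by rewrite {2}PZ mulmxA PV -PZ.
(* Chosen so that [M E = P]: the factor [Y] absorbs the extra [M], leaving
   [M ^+ j *m Z *m P = P *m P]. *)
pose E := M ^+ j *m Y *m Z *m P.
have ME : M *m E = P by rewrite /E !mulmxA -expmxS -MY -PZ PP.
have EP : E *m P = E by rewrite /E -mulmxA PP.
have subE : mxrange E `<=` mxrange (M ^+ j).
  by apply/mxrange_subP; exists (Y *m Z *m P); rewrite /E !mulmxA.
have eqE : mxrange E = mxrange (M ^+ j).
  apply/seteqP; split=> //; apply/mxrange_subP.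
  have [D ED] := (mxrange_subP _ _).1 subE.
  have s : (E^T <= (M ^+ j)^T)%MS by rewrite ED trmx_mul submxMl.
  (* The rank of [E] is at least that of [M ^+ j], because
     [M ^+ j = P *m M ^+ j = M *m E *m M ^+ j]. *)
  have /submxP[D' VD'] : ((M ^+ j)^T <= E^T)%MS.
    rewrite -(geq_leqif (mxrank_leqif_sup s)) !mxrank_tr -PV -ME -mulmxA.
    by apply: leq_trans (mxrankM_maxr _ _) (mxrankM_maxl _ _).
  by exists D'^T; rewrite -[LHS]trmxK VD' trmx_mul trmxK.
exists E; split=> //.
- by rewrite -mulmxA ME EP.
- rewrite eqE; apply/seteqP; split; apply/mxrange_subP.
    by exists (M^t* *m M ^+ j); rewrite mulmxA -trmxC_mul ME Ph PV.
  by exists (Z *m E^t*); rewrite mulmxA -PZ -{1}Ph -trmxC_mul EP.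
Qed.

Section Properties.
Variable k : nat.
Hypothesis le_k : (mx_index M <= k)%N.
Local Notation E := (core_ep M).

Lemma core_ep_outer : E *m M *m E = E.
Proof. by case: core_epP. Qed.

Lemma mxrange_core_ep : exists Z, E = M ^+ k *m Z.
Proof.
have [_ _ eqE] := core_epP; have [Y MY] := mx_index_factor_ge le_k.
have [Z ->] : exists Z, E = M ^+ mx_index M *m Z.
  by apply/mxrange_subP; rewrite eqE.
by exists (Y *m Z); rewrite mulmxA -MY.
Qed.

Lemma core_ep_mul_exp : E *m M *m M ^+ k = M ^+ k.
Proof.
have [_ _ eqE] := core_epP.
have [Z VZ] : exists Z, M ^+ mx_index M = E *m Z.
  by apply/mxrange_subP; rewrite eqE.
by rewrite -(subnKC le_k) expmxD VZ !mulmxA core_ep_outer.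
Qed.

Lemma exp_mul_core_ep : M *m E *m M ^+ k = M ^+ k.
Proof.
(* Factoring through the exponent [k.+1] frees one [M] on the left, which turns [M E] acting on
   [M ^+ k] into [E M] acting on it. *)
have [Y MY] := mx_index_factor_ge (leqW le_k).
have -> : M ^+ k = M *m M ^+ k *m (Y *m M ^+ (k - mx_index M)).
  by rewrite -expmxS mulmxA -MY -expmxD subnKC.
by rewrite !mulmxA -(mulmxA M) -(mulmxA M) core_ep_mul_exp.
Qed.

Lemma mul_core_ep_sqr : M *m E *m E = E.
Proof.
by have [Z EZ] := mxrange_core_ep; rewrite {2}EZ mulmxA exp_mul_core_ep -EZ.
Qed.

(** The range of [E^t*] is that of [E], which [P = M E] fixes; so [P P^* = P^*], and the left side
    is self-adjoint. *)
Lemma mul_core_ep_hermitian : (M *m E)^t* = M *m E.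
Proof.
have [_ eqE _] := core_epP.
have [Z EZ] : exists Z, E^t* = E *m Z by apply/mxrange_subP; rewrite eqE.
have PPh : M *m E *m (M *m E)^t* = (M *m E)^t*.
  by rewrite trmxC_mul EZ !mulmxA mul_core_ep_sqr.
have /(congr1 (fun X => X^t*)) := PPh.
by rewrite (trmxC_mul (M *m E)) trmxCK PPh.
Qed.

(** The product telescopes from the inside by [M E E = E]. The shift excludes exponent [0], where
    the product is the identity. *)
Lemma exp_mul_exp_core_ep j : M ^+ j.+1 *m E ^+ j.+1 = M *m E.
Proof.
elim: j => [|j IH]; first by rewrite !expr1.
rewrite expmxS (expmxSr E) mulmxA -(mulmxA M) IH.
by rewrite -!mulmxA (mulmxA M E) mul_core_ep_sqr.
Qed.

Lemma exp_core_ep_mul_exp j : E ^+ j *m M ^+ j *m M ^+ k = M ^+ k.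
Proof.
elim: j => [|j IH]; first by rewrite !expr0 !mul1mx.
rewrite (expmxS M) (expmxSr E) -!mulmxA expmxC !mulmxA.
rewrite -(mulmxA (E ^+ j)) -(mulmxA (E ^+ j)) core_ep_mul_exp.
by rewrite -mulmxA expmxC mulmxA.
Qed.

End Properties.
End CoreEP.

(** * Reduction of the weighted notions to [M = W A] *)

Section Weighted.
Variables (R : realType) (q n : nat) (W : 'M[R[i]]_(n, q)).

(** Left multiplication by [W] carries the [W]-product to the ordinary one. The shift avoids the
    placeholder value of [wexp] at [0]. *)
Lemma mul_wexpS (X : 'M[R[i]]_(q, n)) l :
  W *m wexp W X l.+1 = (W *m X) ^+ l.+1.
Proof.
rewrite /wexp iteropS; elim: l => [|l IH]; first by rewrite expr1.
by rewrite iterS exprS -IH /wprod -mulmxE !mulmxA.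
Qed.

Lemma weak_group_mpE m (A : 'M[R[i]]_(q, n)) : (0 < m)%N ->
  weak_group_mp W m A =
  core_ep (W *m A) ^+ m.+1 *m (W *m A) ^+ m.+1 *m mp_inv A.
Proof.
case: m => // m _; set M := W *m A; set E := core_ep M.
(* The left side is [M E E]. *)
have WcE : W *m wcore_ep W A = E.
  by rewrite /wcore_ep mulmxA expr2 -mulmxE mulmxA (mul_core_ep_sqr (leqnn _)).
have WgE : W *m weak_group W m.+1 A = E ^+ m.+2 *m M ^+ m.+1.
  by rewrite /weak_group -(mulmxA _ W) mul_wexpS mulmxA mul_wexpS WcE.
rewrite /weak_group_mp WgE -(mulmxA _ W A).
by rewrite (expmxSr M m.+1) (mulmxA (E ^+ _)).
Qed.

End Weighted.

Theorem theorem4p3 (R : realType) (q n p m k : nat)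
    (A : 'M[R[i]]_(q, n)) (W : 'M[R[i]]_(n, q)) (B : 'M[R[i]]_(q, p))
    (hW : W != 0) (hm : (0 < m)%N)
    (hk : k = maxn (mx_index (A *m W)) (mx_index (W *m A))) :
  argmin [set X : 'M[R[i]]_(n, p) | mxrange X `<=` mxrange ((W *m A) ^+ k)]
    (fun X => frobenius_norm (W *m wexp W A m.+1 *m X
                              - W *m wexp W A m.+1 *m mp_inv A *m B))
  = [set weak_group_mp W m A *m B].
Proof.
rewrite weak_group_mpE // mul_wexpS -!mulmxA (mulmxA (core_ep _ ^+ _)).
have le_k : (mx_index (W *m A) <= k)%N by rewrite hk leq_maxr.
move: (W *m A) le_k => {hk} M le_k.
(* Here [N = M ^+ m.+1], [F = core_ep M ^+ m.+1], [P = M *m core_ep M], [V = M ^+ k] and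
   [C = mp_inv A *m B]. *)
apply: argmin_frobenius_projection.
- exact: mul_core_ep_hermitian le_k.
- exact: exp_mul_exp_core_ep le_k _.
- by rewrite expmxSr -!mulmxA (mulmxA (core_ep M)) core_ep_outer.
- by rewrite -!mulmxA (expmxC _ m.+1 k) !mulmxA exp_mul_core_ep.
- exact: exp_core_ep_mul_exp.
- apply/mxrange_subP; have [Z EZ] := mxrange_core_ep le_k.
  by exists (Z *m core_ep M ^+ m); rewrite mulmxA -EZ expmxS.
Qed.
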